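(* Let $(G,\mathcal G,\sigma)$ be a $G$-right-invariant magnetic system on a half-Lie group $G$, with $\sigma$ weakly exact, and assume that the pullback $\hat\sigma$ of $\sigma$ to the universal cover $\hat G$ admits a $\hat G$-right-invariant primitive. Then for all $\kappa>c(G,\mathcal G,\sigma)$ the geodesic distance $d_{\mathcal F^\kappa}$ on $\hat G$ is non-degenerate; that is, the normal subgroup of elements $\hat x\in\hat G$ with vanishing geodesic distance $d_{\mathcal F^\kappa}(e,\hat x)=0$ is trivial.
   Context: Half-Lie groups. A (right) half-Lie group $G$ is a topological group endowed with a smooth (here Banach) manifold structure such that every right translation $\mu^y(x)=xy$ is smooth; left translations are only required to be continuous. $G$ is assumed connected, and $e$ denotes the identity (of $G$ or of $\hat G$). Metrics. A Riemannian metric $\mathcal G$ on $G$ is $G$-right-invariant if $\mathcal G_x(T_e\mu^xv,T_e\mu^xw)=\mathcal G_e(v,w)$ for all $x\in G$, $v,w\in T_eG$. It is strong if $\mathcal G_x$ induces the manifold topology on $T_xG$ for every $x$. Magnetic systems. A $G$-right-invariant magnetic system $(G,\mathcal G,\sigma)$ consists of a half-Lie group $G$, a strong $G$-right-invariant Riemannian metric $\mathcal G$, and a closed $G$-right-invariant two-form $\sigma\in\Omega^2(G)$. Universal cover. Let $\pi\colon\hat G\to G$ be the universal cover with its lifted half-Lie group structure, and let $\hat{\mathcal G}=\pi^*\mathcal G$ and $\hat\sigma=\pi^*\sigma$. The form $\sigma$ is weakly exact if $\hat\sigma$ is exact. Mañé's critical value. If $\sigma$ is weakly exact, $$c(G,\mathcal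 G,\sigma):=\inf_{\mathrm d\hat\alpha=\hat\sigma}\tfrac12\|\hat\alpha\|_\infty^2,\qquad\|\hat\alpha\|_\infty:=\sup_{\hat x\in\hat G}|\hat\alpha_{\hat x}|_{\hat{\mathcal G}},$$ where the infimum is over all $\hat G$-right-invariant primitives $\hat\alpha$ of $\hat\sigma$ and $|\cdot|_{\hat{\mathcal G}}$ is the dual norm. Finsler metric and distance. For $\kappa>c(G,\mathcal G,\sigma)$, let $\hat\alpha$ be a $\hat G$-right-invariant primitive of $\hat\sigma$ with $\tfrac12\|\hat\alpha\|_\infty^2<\kappa$, and set $\mathcal F^\kappa(\hat x,\hat v):=\sqrt{2\kappa}\,|\hat v|_{\hat x}-\hat\alpha_{\hat x}(\hat v)$ with $|\hat v|_{\hat x}=\sqrt{\hat{\mathcal G}_{\hat x}(\hat v,\hat v)}$; this is a right-invariant Finsler metric on $\hat G$. Its geodesic distance is $d_{\mathcal F^\kappa}(\hat x,\hat y)=\inf_\gamma\int_a^b\mathcal F^\kappa_{\gamma(t)}(\dot\gamma(t))\,\mathrm dt$, the infimum being over piecewise smooth curves $\gamma\colon[a,b]\to\hat G$ from $\hat x$ to $\hat y$. *)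

(* Defs.v *)
From HB Require Import structures.
From mathcomp Require Import all_boot all_order all_algebra.
From mathcomp Require Import all_classical all_reals all_analysis.

Set Implicit Arguments.
Unset Strict Implicit.
Unset Printing Implicit Defensive.

Import Order.TTheory GRing.Theory Num.Theory.
Import numFieldTopology.Exports numFieldNormedType.Exports.

Local Open Scope classical_set_scope.
Local Open Scope ring_scope.

(* Frechet C^oo maps on an open set U.  [D n x v] is the n-th derivative at x,
   a bounded n-linear map evaluated at v = (v_1, ..., v_n); the last clause says
   that D n is Frechet differentiable at x for the operator norm on n-linear
   maps, with derivative D n.+1 x.  Linearity of D n in the slots other than the
   first is inherited from D n.-1 by taking limits of difference quotients. *)
Definition smooth_on (R : realType) (V W : normedModType R)
    (U : set V) (f : V -> W) : Prop :=
  exists D : forall n, V -> n.-tuple V -> W,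
    (forall x, U x -> D 0%N x [tuple] = f x) /\
    forall n x, U x ->
      [/\ forall v : n.-tuple V, linear (fun h => D n.+1 x [tuple of h :: v]),
          exists C : R, forall v : n.+1.-tuple V,
            `|D n.+1 x v| <= C * \prod_(i < n.+1) `|tnth v i|
        & forall e : R, 0 < e -> \forall h \near (0 : V),
            forall v : n.-tuple V,
              `|D n (x + h) v - D n x v - D n.+1 x [tuple of h :: v]|
                <= e * `|h| * \prod_(i < n) `|tnth v i| ].

(* Smooth Hausdorff manifolds modelled on the Banach space E.  The atlas is
   indexed by the points of M: [chart x] is a chart around x, with domain
   [chart_dom x] and inverse [chart_inv x]. *)
HB.mixin Record isBanachManifold (R : realType) (E : completeNormedModType R)
    M & Topological M := {
  manifold_hausdorff : hausdorff_space M ;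
  chart : M -> M -> E ;
  chart_inv : M -> E -> M ;
  chart_dom : M -> set M ;
  chart_dom_open : forall x, open (chart_dom x) ;
  chart_dom_base : forall x, chart_dom x x ;
  chart_img_open : forall x, open (chart x @` chart_dom x) ;
  chartK : forall x, {in chart_dom x, cancel (chart x) (chart_inv x)} ;
  chart_continuous : forall x, {in chart_dom x, continuous (chart x)} ;
  chart_inv_continuous : forall x,
    {in chart x @` chart_dom x, continuous (chart_inv x)} ;
  chart_transition : forall x y,
    smooth_on (chart x @` (chart_dom x `&` chart_dom y))
      (chart y \o chart_inv x)
}.

#[short(type="banachManifoldType")]
HB.structure Definition BanachManifold (R : realType)
    (E : completeNormedModType R) :=
  {M of Topological M & isBanachManifold R E M}.

Section Manifolds.
Context {R : realType} {E : completeNormedModType R}.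

Definition chart_img (M : banachManifoldType E) (x : M) : set E :=
  chart x @` chart_dom x.

Definition smooth_map_on (M N : banachManifoldType E) (U : set M)
    (f : M -> N) : Prop :=
  {in U, continuous f} /\
  forall x y, smooth_on
    (chart x @` (U `&` chart_dom x `&` f @^-1` chart_dom y))
    (chart y \o f \o chart_inv x).

Definition smooth_map (M N : banachManifoldType E) (f : M -> N) : Prop :=
  smooth_map_on setT f.

End Manifolds.

HB.mixin Record isHalfLieGroup (R : realType) (E : completeNormedModType R)
    G & BanachManifold R E G & Group G := {
  mulg_continuous : continuous (fun p : G * G => (p.1 * p.2)%g) ;
  invg_continuous : continuous (fun x : G => (x^-1)%g) ;
  mulgr_smooth : forall y : G, smooth_map (fun x : G => (x * y)%g)
}.

#[short(type="halfLieGroupType")]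
HB.structure Definition HalfLieGroup (R : realType)
    (E : completeNormedModType R) :=
  {G of BanachManifold R E G & Group G & isHalfLieGroup R E G}.

Section TensorFields.
Context {R : realType} {E : completeNormedModType R}.
Implicit Types M N : banachManifoldType E.

(* T_xM, identified with E through the chart [chart x]. *)
Definition tangent M (x : M) : completeNormedModType R := E.

Definition tangent_map M N (f : M -> N) (x : M) : tangent x -> tangent (f x) :=
  'd (chart (f x) \o f \o chart_inv x) (chart x x).

(* The tangent vector at [chart_inv x z] whose coordinates in the chart
   [chart x] are v. *)
Definition chart_vector M (x : M) (z v : E) : tangent (chart_inv x z) :=
  'd (chart (chart_inv x z) \o chart_inv x) z v.

Definition covector_field M := forall x : M, tangent x -> R.
Definition bilinear_field M := forall x : M, tangent x -> tangent x -> R.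

Definition local1 M (alpha : covector_field M) (x : M) (z v : E) : R^o :=
  alpha (chart_inv x z) (chart_vector x z v).

Definition local2 M (b : bilinear_field M) (x : M) (z v w : E) : R^o :=
  b (chart_inv x z) (chart_vector x z v) (chart_vector x z w).

Definition smooth_bilinear_field M (b : bilinear_field M) : Prop :=
  [/\ forall x v, scalar (b x v),
      forall x w, scalar (b x ^~ w)
    & forall x, smooth_on [set q : E * E * E | chart_img x q.1.1]
        (fun q => local2 b x q.1.1 q.1.2 q.2) ].

Definition is_1form M (alpha : covector_field M) : Prop :=
  (forall x, scalar (alpha x)) /\
  forall x, smooth_on [set q : E * E | chart_img x q.1]
    (fun q => local1 alpha x q.1 q.2).

Definition is_2form M (sigma : bilinear_field M) : Prop :=
  smooth_bilinear_field sigma /\ forall x v, sigma x v v = 0.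

(* Exterior derivatives at x, computed in the chart [chart x], in which
   vectors of T_xM are their own coordinates. *)
Definition d1 M (alpha : covector_field M) : bilinear_field M :=
  fun x u v =>
    'D_u (fun z => local1 alpha x z v) (chart x x)
    - 'D_v (fun z => local1 alpha x z u) (chart x x).

Definition d2 M (sigma : bilinear_field M) (x : M) (u v w : tangent x) : R :=
  'D_u (fun z => local2 sigma x z v w) (chart x x)
  - 'D_v (fun z => local2 sigma x z u w) (chart x x)
  + 'D_w (fun z => local2 sigma x z u v) (chart x x).

Definition closed_2form M (sigma : bilinear_field M) : Prop :=
  is_2form sigma /\ forall x u v w, @d2 M sigma x u v w = 0.

Definition primitive M (sigma : bilinear_field M) (alpha : covector_field M) :=
  is_1form alpha /\ forall x u v, d1 alpha (x := x) u v = sigma x u v.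

Definition exact_2form M (sigma : bilinear_field M) : Prop :=
  exists alpha, primitive sigma alpha.

Definition riemannian_metric M (g : bilinear_field M) : Prop :=
  [/\ smooth_bilinear_field g,
      forall x v w, g x v w = g x w v
    & forall x v, v != 0 -> 0 < g x v v].

Definition riem_norm M (g : bilinear_field M) (x : M) (v : tangent x) : R :=
  Num.sqrt (g x v v).

Definition strong_metric M (g : bilinear_field M) : Prop :=
  forall (x : M) (v : tangent x) (A : set (tangent x)),
    nbhs v A <->
    exists2 e : R, 0 < e & [set w | riem_norm g (w - v) < e] `<=` A.

Definition pullback1 M N (f : M -> N) (alpha : covector_field N) :
    covector_field M :=
  fun x v => alpha (f x) (tangent_map f v).

Definition pullback2 M N (f : M -> N) (b : bilinear_field N) :
    bilinear_field M :=
  fun x v w => b (f x) (tangent_map f v) (tangent_map f w).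

Local Open Scope ereal_scope.

Definition dual_norm M (g : bilinear_field M) (alpha : covector_field M)
    (x : M) : \bar R :=
  ereal_sup [set (`|alpha x v|%R)%:E | v in
    [set v : tangent x | (riem_norm g v <= 1)%R]].

Definition sup_norm M (g : bilinear_field M) (alpha : covector_field M) :
    \bar R :=
  ereal_sup [set dual_norm g alpha x | x in [set: M]].

End TensorFields.

Section MagneticSystems.
Context {R : realType} {E : completeNormedModType R}.
Implicit Types G : halfLieGroupType E.

Definition right_translation G (y : G) : G -> G := fun x => (x * y)%g.

Definition right_invariant_metric G (g : bilinear_field G) : Prop :=
  forall (x : G) (v w : tangent (1%g : G)),
    pullback2 (right_translation x) g v w = g 1%g v w.

Definition right_invariant1 G (alpha : covector_field G) : Prop :=
  forall (y x : G) v,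
    pullback1 (right_translation y) alpha (x := x) v = alpha x v.

Definition right_invariant2 G (sigma : bilinear_field G) : Prop :=
  forall (y x : G) v w,
    pullback2 (right_translation y) sigma (x := x) v w = sigma x v w.

Definition magnetic_system G (g sigma : bilinear_field G) : Prop :=
  [/\ riemannian_metric g, strong_metric g, right_invariant_metric g,
      closed_2form sigma & right_invariant2 sigma].

Definition invariant_primitive G (sigma : bilinear_field G)
    (alpha : covector_field G) : Prop :=
  primitive sigma alpha /\ right_invariant1 alpha.

End MagneticSystems.

Section UniversalCover.
Context {R : realType}.

Definition simply_connected (T : topologicalType) : Prop :=
  [set: T] !=set0 /\
  (forall x y : T, exists c : R -> T,
    [/\ {within `[0, 1], continuous c}, c 0 = x & c 1 = y]) /\
  (forall c : R -> T, {within `[0, 1], continuous c} -> c 0 = c 1 ->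
    exists H : R * R -> T,
      [/\ {within `[0, 1] `*` `[0, 1], continuous H},
          {in `[0, 1], forall t, H (0, t) = c t},
          {in `[0, 1], forall t, H (1, t) = c 0}
        & {in `[0, 1], forall s, H (s, 0) = c 0 /\ H (s, 1) = c 0}]).

Definition covering_map (S T : topologicalType) (p : S -> T) : Prop :=
  [/\ continuous p,
      forall y, exists x, p x = y
    & forall y : T, exists V : set T, [/\ open V, V y &
        exists (I : Type) (sheet : I -> set S),
          [/\ p @^-1` V = \bigcup_i sheet i,
              trivIset setT sheet
            & forall i, [/\ open (sheet i), set_bij (sheet i) V p &
                forall A, open A -> A `<=` sheet i -> open (p @` A)]]]].

Definition local_diffeomorphism {E : completeNormedModType R}
    (M N : banachManifoldType E) (f : M -> N) : Prop :=
  forall x : M, exists (U : set M) (h : N -> M),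
    [/\ open U, U x, open (f @` U), smooth_map_on U f &
        smooth_map_on (f @` U) h /\ {in U, cancel f h}].

Definition universal_cover {E : completeNormedModType R}
    (G Ghat : halfLieGroupType E) (p : Ghat -> G) : Prop :=
  [/\ {morph p : x y / (x * y)%g}, covering_map p, local_diffeomorphism p
    & simply_connected Ghat].

Definition weakly_exact {E : completeNormedModType R}
    (G Ghat : halfLieGroupType E) (p : Ghat -> G)
    (sigma : bilinear_field G) : Prop :=
  exact_2form (pullback2 p sigma).

Local Open Scope ereal_scope.

(* c(G, g, sigma), computed on the universal cover p : Ghat -> G. *)
Definition mane_critical_value {E : completeNormedModType R}
    (G Ghat : halfLieGroupType E) (p : Ghat -> G)
    (g sigma : bilinear_field G) : \bar R :=
  ereal_inf [set (2^-1)%:E * sup_norm (pullback2 p g) alpha ^+ 2 | alpha in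
    [set alpha | invariant_primitive (pullback2 p sigma) alpha]].

End UniversalCover.

Section GeodesicDistance.
Context {R : realType} {E : completeNormedModType R}.
Implicit Types M : banachManifoldType E.

Definition smooth_curve_on M (J : set R) (c : R -> M) : Prop :=
  {in J, continuous c} /\
  forall x, smooth_on (J `&` c @^-1` chart_dom x : set R^o) (chart x \o c).

(* Piecewise smooth on [a, b]: continuous, and on each of the intervals
   [t_i, t_(i+1)] of a subdivision equal to a curve which is smooth on a
   neighbourhood of that interval. *)
Definition piecewise_smooth M (a b : R) (c : R -> M) : Prop :=
  {within `[a, b], continuous c} /\
  exists2 s : seq R, itv_partition a b s &
    forall i, (i < size s)%N ->
      let I := `[nth b (a :: s) i, nth b s i] in
      exists (J : set R) (c' : R -> M),
        [/\ open J, [set` I] `<=` J, smooth_curve_on J c'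
          & {in I, forall t, c t = c' t}].

(* At the finitely many t in [a, b] which are end points of pieces this value
   need not be meaningful; it does not matter in the integral below. *)
Definition velocity M (c : R -> M) (t : R) : tangent (c t) :=
  derive1 (chart (c t) \o c) t.

Definition finsler_length M (F : covector_field M) (a b : R) (c : R -> M) :
    \bar R :=
  (\int[lebesgue_measure]_(t in `[a, b]) (F (c t) (velocity c t))%:E)%E.

Definition geodesic_distance M (F : covector_field M) (x y : M) : \bar R :=
  ereal_inf [set l | exists (a b : R) (c : R -> M),
    [/\ a <= b, piecewise_smooth a b c, c a = x, c b = y
      & l = finsler_length F a b c]].

Definition magnetic_finsler M (g : bilinear_field M) (alpha : covector_field M)
    (kappa : R) : covector_field M :=
  fun x v => Num.sqrt (2 * kappa) * riem_norm g v - alpha x v.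

Definition nondegenerate_distance M (d : M -> M -> \bar R) : Prop :=
  forall x y, d x y = 0%E -> x = y.

End GeodesicDistance.

(* Main.v *)
From HB Require Import structures.
Require Import Defs.
From mathcomp Require Import all_boot all_order all_algebra.
From mathcomp Require Import all_classical all_reals all_analysis.
From mathcomp Require Import ring lra.

(** Near each point the geodesic distance is bounded below by a multiple of a
chart norm.  The modelling space may be infinite-dimensional, so compactness of
small closed balls cannot be used: uniform estimates come from smoothness, and
curves are confined by regularity of topological groups.

Write ghat for the lifted metric.  The condition on kappa says that the
covector alpha has norm n < sqrt (2 kappa), so the Finsler metric satisfies
F v >= delta |v| for the ghat-norm, with delta := sqrt (2 kappa) - n > 0
([magnetic_finsler_bound]).  It remains to bound ghat-lengths from below.

Fix x in the cover.  The function psi := chart o p, for a chart of G around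
p x, is a homeomorphism from a neighbourhood of x onto an open set of E.
Because g is strong, its norm at p x dominates a multiple of the norm of E;
because g is smooth, the bilinear forms which represent it in the chart depend
continuously on the point for the operator norm, so that the same estimate,
with a smaller constant m, holds uniformly near p x
([strong_metric_lower_bound]).  By the chain rule the ghat-norm of the
velocity of a curve c is the norm of (psi o c)' measured by these forms
([pullback2_velocity]).  Hence F (c') >= delta m |(psi o c)'| while c stays
near x, and integrating gives length >= delta m |psi (c t) - psi x|.

A curve from x to y <> x must leave every small neighbourhood of x that avoids
y.  A topological group is regular, so some neighbourhood N of x has its
closure inside the domain of psi, and for small rho the points of the domain
with |psi u - psi x| < rho lie in N.  A curve shorter than delta m rho can
never reach the psi-sphere of radius rho, and it cannot escape in any other
way, because its limit points stay in the closure of N, hence in the domain of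
psi ([trapped_curve]).  So each curve from x to y has length at
least delta m rho ([finsler_length_lower_bound]).

The integration step compares, to the right of each t, the increments of the
length with those of psi o c, and concludes by real induction.  The integral of
a nonnegative function is a supremum over simple functions, hence superadditive
over disjoint sets ([ge0_integral_superadd]); this bounds the increments of the
length from below. *)

Import Order.TTheory GRing.Theory Num.Theory.
Import numFieldTopology.Exports numFieldNormedType.Exports.

Local Open Scope classical_set_scope.
Local Open Scope ring_scope.

Set Implicit Arguments.
Unset Strict Implicit.
Unset Printing Implicit Defensive.

(** * Continuously differentiable maps between normed spaces *)

Section Calculus.
Context {R : realType}.
Implicit Types V W : normedModType R.

(** Differentiability at x with an explicit candidate for the derivative, free
of the choice made by the notation for differentials. *)
Definition frechet_at {V W} (f : V -> W) (x : V) (d : V -> W) : Prop :=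
  [/\ linear d, exists C, forall h, `|d h| <= C * `|h|
    & forall e : R, 0 < e -> \forall h \near (0 : V),
        `|f (x + h) - f x - d h| <= e * `|h| ].

Lemma frechet_diff {V W} (f : V -> W) x d : frechet_at f x d ->
  differentiable f x /\ 'd f x = d :> (V -> W).
Proof.
move=> [dlin [C dC] df].
pose L : {linear V -> W} := HB.pack d (GRing.isLinear.Build _ _ _ _ d dlin).
have Lc : continuous L.
  apply/linear_bounded_continuous; apply/linear_boundedP.
  exists C; split; first exact: num_real.
  by move=> M /ltW CM y; apply: (le_trans (dC y)); apply: ler_wpM2r.
have Lo : f \o shift x = cst (f x) + L +o_ (0 : V) id.
  apply/eqaddoP => e e0; near=> h => /=.
  rewrite !fctE/= opprD addrA [h + x]addrC.
  by near: h; exact: df.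
have dE := diff_unique Lc Lo.
split=> //; apply/diff_locallyP; rewrite dE; split=> //; exact: Lc.
Unshelve. all: by end_near. Qed.

(** The derivative exists near x but need be continuous, for the operator norm,
at x only: this pointwise form composes without tracking domains. *)
Definition C1_at {V W} (f : V -> W) (x : V) : Prop :=
  (\forall z \near x, differentiable f z) /\
  forall e : R, 0 < e -> \forall z \near x,
    forall h, `|'d f z h - 'd f x h| <= e * `|h|.

Lemma nbhs_shift0 {V} (x : V) (P : set V) :
  (\forall h \near (0 : V), P (x + h)) -> \forall z \near x, P z.
Proof.
move=> /nbhs_normP[e /= e0 eP]; apply/nbhs_normP; exists e => //= z /= xz.
have := eP (z - x); rewrite [x + _]addrC subrK; apply.
by rewrite /= sub0r normrN distrC.
Qed.

Lemma near0_shift {V} (x : V) (P : set V) :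
  (\forall z \near x, P z) -> \forall h \near (0 : V), P (x + h).
Proof.
move=> /nbhs_normP[e /= e0 eP]; apply/nbhs_normP; exists e => //= h /= xh.
by apply: eP; rewrite /= opprD addrA subrr.
Qed.

(** The body of [smooth_on], for a given choice of the higher derivatives. *)
Definition derivative_family {V W} (U : set V) (f : V -> W)
    (D : forall n, V -> n.-tuple V -> W) : Prop :=
  (forall x, U x -> D 0%N x [tuple] = f x) /\
  forall n x, U x ->
    [/\ forall v : n.-tuple V, linear (fun h => D n.+1 x [tuple of h :: v]),
        exists C : R, forall v : n.+1.-tuple V,
          `|D n.+1 x v| <= C * \prod_(i < n.+1) `|tnth v i|
      & forall e : R, 0 < e -> \forall h \near (0 : V),
          forall v : n.-tuple V,
            `|D n (x + h) v - D n x v - D n.+1 x [tuple of h :: v]|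
              <= e * `|h| * \prod_(i < n) `|tnth v i| ].

Lemma derivative_family_frechet {V W} (U : set V) (f : V -> W) D x :
  derivative_family U f D -> nbhs x U ->
  frechet_at f x (fun h => D 1%N x [tuple of h :: [tuple]]).
Proof.
move=> [D0 DS] Ux; have [l [C b] d] := DS 0%N x (nbhs_singleton Ux).
split; first exact: l.
- by exists C => h; have := b [tuple of h :: [tuple]]; rewrite big_ord1.
- move=> e e0; have := d e e0.
  have Uh : \forall h \near (0 : V), U (x + h) by exact: near0_shift.
  move=> dh; near=> h.
  have := near dh h; move=> /(_ _)/(_ [tuple]); rewrite big_ord0 mulr1 !D0;
    first by apply.
    exact: nbhs_singleton.
  by near: h.
Unshelve. all: by end_near. Qed.

(** Each derivative D n is differentiable at x for the operator norm, hence
continuous there. *)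
Lemma derivative_family_cts {V W} (U : set V) (f : V -> W) D n x :
  derivative_family U f D -> U x -> forall e : R, 0 < e ->
  \forall z \near x, forall v : n.-tuple V,
    `|D n z v - D n x v| <= e * \prod_(i < n) `|tnth v i|.
Proof.
move=> [_ DS] Ux e e0; have [_ [C b] d] := DS n x Ux.
apply: nbhs_shift0.
have C0 : 0 < `|C| + 1 by rewrite ltr_wpDl.
near=> h => v.
have Pge0 : 0 <= \prod_(i < n) `|tnth v i| by apply: prodr_ge0.
have h1 : `|D n (x + h) v - D n x v - D n.+1 x [tuple of h :: v]|
    <= 1 * `|h| * \prod_(i < n) `|tnth v i|.
  by move: v {Pge0}; near: h; exact: d.
have h2 : `|D n.+1 x [tuple of h :: v]| <= `|C| * `|h| * \prod_(i < n) `|tnth v i|.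
  apply: (le_trans (b _)); rewrite big_ord_recl /= tnth0.
  under eq_bigr do rewrite tnthS.
  by rewrite mulrA !ler_wpM2r// ler_norm.
have h3 : (`|C| + 1) * `|h| <= e.
  rewrite mulrC -ler_pdivlMr//; near: h; apply: nbhs0_le; exact: divr_gt0.
apply: (@le_trans _ _ ((`|C| + 1) * `|h| * \prod_(i < n) `|tnth v i|)); last first.
  exact: ler_wpM2r.
rewrite -[X in `|X|](subrK (D n.+1 x [tuple of h :: v])).
apply: (le_trans (ler_normD _ _)); rewrite !mulrDl; lra.
Unshelve. all: by end_near. Qed.

Lemma smooth_on_C1 {V W} (U : set V) (f : V -> W) x :
  smooth_on U f -> nbhs x U -> C1_at f x.
Proof.
move=> [D DF] Ux.
pose d z h := D 1%N z [tuple of h :: [tuple]].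
have df : \forall z \near x, frechet_at f z (d z).
  near=> z; apply: derivative_family_frechet; first exact: DF.
  by near: z; apply/nbhs_interior.
split; first by near=> z; apply: (@frechet_diff _ _ f z (d z) _).1; near: z.
move=> e e0; near=> z => h.
have dfz : frechet_at f z (d z) by near: z.
rewrite (frechet_diff dfz).2 (frechet_diff (nbhs_singleton df)).2.
suff : forall v : 1.-tuple V,
    `|D 1%N z v - D 1%N x v| <= e * \prod_(i < 1) `|tnth v i|.
  by move=> /(_ [tuple of h :: [tuple]]); rewrite big_ord1.
clear h; near: z; exact: derivative_family_cts DF (nbhs_singleton Ux) _ e0.
Unshelve. all: by end_near. Qed.

Lemma diff_frechet {V W} (f : V -> W) x :
  differentiable f x -> frechet_at f x ('d f x).
Proof.
move=> df; split; first exact: linearP.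
- have /linear_bounded_continuous/linear_boundedP[M [_ HM]] := diff_continuous df.
  by exists (M + 1); apply: HM; rewrite ltrDl.
- have /eqaddoP H := diff_locally df.
  move=> e e0; have := H e e0; apply: filterS => h.
  by rewrite !fctE/= opprD addrA [h + x]addrC.
Qed.

Lemma near_eq_diff {V W} (f g : V -> W) x :
  (\forall z \near x, f z = g z) -> differentiable f x ->
  differentiable g x /\ 'd g x = 'd f x :> (V -> W).
Proof.
move=> fg /diff_frechet[l b d]; apply: frechet_diff; split=> // e e0.
have fgh := near0_shift fg; have := d e e0.
apply: filter_app; near=> h => /=.
rewrite -(nbhs_singleton fg); suff -> : f (x + h) = g (x + h) by [].
by near: h.
Unshelve. all: by end_near. Qed.

Lemma C1_near_eq {V W} (f g : V -> W) x :
  (\forall z \near x, f z = g z) -> C1_at f x -> C1_at g x.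
Proof.
move=> fg [df cf].
have fgz : \forall z \near x, differentiable g z /\ 'd g z = 'd f z :> (V -> W).
  have := near_join fg; apply: filter_app; near=> z => fgz.
  by apply: near_eq_diff => //; near: z.
split; first by apply: filterS fgz => z [].
move=> e e0; have := cf e e0; apply: filter_app; near=> z.
have [_ ->] : differentiable g z /\ 'd g z = 'd f z :> (V -> W) by near: z.
by rewrite (nbhs_singleton fgz).2.
Unshelve. all: by end_near. Qed.

Lemma C1_continuous {V W} (f : V -> W) x : C1_at f x -> {for x, continuous f}.
Proof. by move=> [/nbhs_singleton df _]; exact: differentiable_continuous. Qed.

Lemma C1_comp {V W X : normedModType R} (f : V -> W) (g : W -> X) x :
  C1_at f x -> C1_at g (f x) -> C1_at (g \o f) x.
Proof.
move=> Cf Cg; have fc := C1_continuous Cf.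
move: Cf Cg => [df cf] [dg cg].
have dgf : \forall z \near x, differentiable g (f z) := fc _ dg.
split.
  near=> z; have dfz : differentiable f z by near: z.
  have dgz : differentiable g (f z) by near: z.
  exact: differentiable_comp.
have [_ [A bA] _] := diff_frechet (nbhs_singleton df).
have [_ [B bB] _] := diff_frechet (nbhs_singleton dg).
move=> e e0.
have A0 : 0 < `|A| + 1 by rewrite ltr_wpDl.
have B0 : 0 < `|B| + 1 by rewrite ltr_wpDl.
have e1 : 0 < e / 2 / (`|A| + 1) by rewrite !divr_gt0.
have e2 : 0 < Num.min 1 (e / 2 / (`|B| + 1)) by rewrite lt_min ltr01 !divr_gt0.
have cgf : \forall z \near x, forall h,
    `|'d g (f z) h - 'd g (f x) h| <= e / 2 / (`|A| + 1) * `|h|.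
  exact: fc _ (cg _ e1).
near=> z => h.
have dfz : differentiable f z by near: z.
have dgz : differentiable g (f z) by near: z.
rewrite (diff_comp dfz dgz) (diff_comp (nbhs_singleton df) (nbhs_singleton dg)) /=.
set u := 'd f z h; set v := 'd f x h.
have Huv : `|u - v| <= Num.min 1 (e / 2 / (`|B| + 1)) * `|h|.
  by rewrite /u /v; move: (h); near: z; exact: cf.
have Hv : `|v| <= `|A| * `|h|.
  by apply: (le_trans (bA _)); rewrite ler_wpM2r// ler_norm.
have Hu : `|u| <= (`|A| + 1) * `|h|.
  rewrite -(subrK v u); apply: (le_trans (ler_normD _ _)).
  rewrite mulrDl mul1r addrC lerD//; apply: (le_trans Huv).
  by rewrite ler_piMl// ge_min lexx.
have Hg : `|'d g (f z) u - 'd g (f x) u| <= e / 2 / (`|A| + 1) * `|u|.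
  by move: (u); near: z; exact: cgf.
have -> : 'd g (f z) u - 'd g (f x) v =
    ('d g (f z) u - 'd g (f x) u) + 'd g (f x) (u - v).
  by rewrite linearB/= addrA subrK.
apply: (le_trans (ler_normD _ _)); rewrite [e]splitr mulrDl lerD//.
  apply: (le_trans Hg); rewrite -mulrA ler_pM2l; last by rewrite divr_gt0.
  by rewrite mulrC ler_pdivrMr// mulrC.
apply: (le_trans (bB _)); apply: (@le_trans _ _ ((`|B| + 1) * `|u - v|)).
  rewrite ler_wpM2r//; apply: (le_trans (ler_norm _)); lra.
rewrite mulrC -ler_pdivlMr//; apply: (le_trans Huv).
rewrite [leRHS]mulrAC ler_wpM2r//.
by rewrite ge_min lexx orbT.
Unshelve. all: by end_near. Qed.

(** Both bounds compare with the number |c' t|, one for the displacement of the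
curve and one for its speed; together they control displacement by length to
first order. *)
Lemma C1_curve_bounds {V} (c : R^o -> V) (t : R) (e : R) : C1_at c t -> 0 < e ->
  \forall s \near t, [/\ `|c s - c t| <= (`|'d c t 1| + e) * `|s - t|,
    `|'d c t 1| - e <= `|'d c s 1| & differentiable c s].
Proof.
move=> [dc cc] e0.
have [l _ /(_ e e0) d] := diff_frechet (nbhs_singleton dc).
have {}d : \forall s \near (t : R^o), `|c s - c t - 'd c t (s - t)| <= e * `|s - t|.
  apply: nbhs_shift0; apply: filterS d => h.
  by rewrite [t + h - t]addrAC subrr add0r.
near=> s; split; last by near: s.
- have H : `|c s - c t - 'd c t (s - t)| <= e * `|s - t| by near: s.
  have -> : c s - c t = (c s - c t - 'd c t (s - t)) + (s - t) *: 'd c t 1.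
    by rewrite -linearZ/= [_ *: 1]mulr1 subrK.
  apply: (le_trans (ler_normD _ _)); rewrite normrZ mulrDl; lra.
- have : `|'d c s 1 - 'd c t 1| <= e * `|1 : R^o|.
    by move: (1 : R^o); near: s; exact: cc.
  rewrite normr1 mulr1 => H; rewrite lerBlDl addrC -lerBlDl.
  by apply: le_trans H; rewrite distrC; exact: lerB_dist.
Unshelve. all: by end_near. Qed.
End Calculus.

(** * Smooth families of bilinear maps *)

Section BilinearFamilies.
Context {R : realType}.
Implicit Types V W : normedModType R.

(** Directional derivatives determine D n.+1: along a line on which D n is
affine near x, D n.+1 is its slope. *)
Lemma derivative_family_dir {V W} (U : set V) (f : V -> W) D n x h
    (v : n.-tuple V) (y : W) :
  derivative_family U f D -> U x ->
  (\forall t \near (0 : R), D n (x + t *: h) v = D n x v + t *: y) ->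
  D n.+1 x [tuple of h :: v] = y.
Proof.
move=> [_ DS] Ux Dt; have [l _ d] := DS n x Ux.
have [L LE] : exists L : {linear V -> W}, forall k, L k = D n.+1 x [tuple of k :: v].
  pose dk k := D n.+1 x [tuple of k :: v].
  by exists (HB.pack_for {linear V -> W} dk (GRing.isLinear.Build _ _ _ _ dk (l v))).
apply/subr0_eq/eqP; rewrite -normr_le0; apply/ler_addgt0Pr => e e0; rewrite add0r.
set P := \prod_(i < n) `|tnth v i|.
have P0 : 0 <= P by apply: prodr_ge0.
have C0 : 0 < `|h| * P + 1 by rewrite ltr_wpDl// mulr_ge0.
have e1 : 0 < e / (`|h| * P + 1) by rewrite divr_gt0.
have dt : \forall t \near (0 : R), forall v : n.-tuple V,
    `|D n (x + t *: h) v - D n x v - D n.+1 x [tuple of (t *: h) :: v]|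
                <= e / (`|h| * P + 1) * `|t *: h| * \prod_(i < n) `|tnth v i|.
  have : (t *: h) @[t --> (0 : R)] --> (0 : V).
    by rewrite -[X in _ --> X](scale0r h); apply: cvgZr_tmp; exact: cvg_id.
  by move=> /(_ _ (d _ e1)).
have [r /= r0 H] : \forall t \near (0 : R), D n (x + t *: h) v = D n x v + t *: y /\
   forall v : n.-tuple V,
    `|D n (x + t *: h) v - D n x v - D n.+1 x [tuple of (t *: h) :: v]|
                <= e / (`|h| * P + 1) * `|t *: h| * \prod_(i < n) `|tnth v i|.
  by near=> t; split; [near: t; exact: Dt|near: t; exact: dt].
have r2 : 0 < r / 2 by rewrite divr_gt0.
have [|E /(_ v)] := H (r / 2).
  by rewrite /= sub0r normrN gtr0_norm// gtr_pMr// invf_lt1// ltr1n.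
rewrite E [_ + _ *: y]addrC addrK -LE linearZ/= LE -scalerBr !normrZ distrC.
rewrite -/P -normrM (gtr0_norm r2) [X in _ <= X -> _](_ : _ =
  (r / 2) * (e / (`|h| * P + 1) * (`|h| * P))); last by ring.
rewrite ler_pM2l// => /le_trans; apply.
by rewrite mulrAC ler_pdivrMr// ler_pM2l// lerDl.
Unshelve. all: by end_near. Qed.

(** Joint continuity of (z, v, w) |-> B z v w would not give continuity of
z |-> B z for the operator norm.  Smoothness does: differentiating at (z, 0, 0)
in the directions (0, 0, w) and (0, v, 0) gives back B z v w, so B z is part of
the second derivative at (z, 0, 0), which depends continuously on z. *)
Lemma smooth_bilinear_family_cts {V W} (U : set V) (B : V -> V -> V -> W) z0 :
  (forall z v, U z -> linear (B z v)) -> (forall z w, U z -> linear (B z ^~ w)) ->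
  smooth_on [set q : V * V * V | U q.1.1] (fun q => B q.1.1 q.1.2 q.2) ->
  nbhs z0 U -> forall e : R, 0 < e ->
  \forall z \near z0, forall v w, `|B z v w - B z0 v w| <= e * (`|v| * `|w|).
Proof.
move=> Bl Br [D DF] Uz0 e e0.
have Bl0 z v : U z -> B z v 0 = 0.
  by move=> Uz; have := Bl z v Uz (-1) 0 0; rewrite scaler0 addr0 scaleN1r addNr.
have BlZ z v t w : U z -> B z v (t *: w) = t *: B z v w.
  by move=> Uz; have := Bl z v Uz t w 0; rewrite !addr0 Bl0// addr0.
have Br0 z w : U z -> B z 0 w = 0.
  by move=> Uz; have := Br z w Uz (-1) 0 0; rewrite scaler0 addr0 scaleN1r addNr.
have BrZ z t v w : U z -> B z (t *: v) w = t *: B z v w.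
  by move=> Uz; have := Br z w Uz t v 0; rewrite !addr0 Br0// addr0.
pose l w : V * V * V := (0, 0, w); pose k v : V * V * V := (0, v, 0).
have lE w : `|l w| = `|w|.
  by rewrite !prod_normE/= !normr0 maxxx max_r.
have kE v : `|k v| = `|v|.
  by rewrite !prod_normE/= !normr0 max_l ?max_r// le_max lexx.
have D1E z a w : U z -> D 1%N (z, a, 0) [tuple of l w :: [tuple]] = B z a w.
  move=> Uz; apply: (derivative_family_dir DF) => //.
  apply: (@nearW _ (nbhs (0 : R))) => t.
  have -> : (z, a, 0) + t *: l w = (z, a, t *: w).
    rewrite [LHS](_ : _ = (z + t *: 0, a + t *: 0, 0 + t *: w))//.
    by rewrite !scaler0 !addr0 add0r.
  by rewrite !DF.1//= Bl0// add0r BlZ.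
have D2E z v w : U z ->
    D 2%N (z, 0, 0) [tuple of k v :: [tuple of l w :: [tuple]]] = B z v w.
  move=> Uz; apply: (derivative_family_dir DF) => //.
  apply: (@nearW _ (nbhs (0 : R))) => t.
  have -> : (z, 0, 0) + t *: k v = (z, t *: v, 0).
    rewrite [LHS](_ : _ = (z + t *: 0, 0 + t *: v, 0 + t *: 0))//.
    by rewrite !scaler0 !addr0 add0r.
  by rewrite !D1E//= Br0// add0r BrZ.
have Uq0 : [set q : V * V * V | U q.1.1] (z0, 0, 0).
  by move: (nbhs_singleton Uz0).
have H : \forall z \near z0, forall v : 2.-tuple (V * V * V),
    `|D 2%N (z, 0, 0) v - D 2%N (z0, 0, 0) v| <= e * \prod_(i < 2) `|tnth v i|.
  have /nbhs_normP[r r0 rP] := derivative_family_cts 2 DF Uq0 e0.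
  apply/nbhs_normP; exists r => // z /= zr; apply: rP => /=.
  by rewrite !prod_normE/= subrr normr0 !max_l.
near=> z => v w.
have Uz : U z by near: z.
have Uz' := nbhs_singleton Uz0.
suff : forall v : 2.-tuple (V * V * V),
    `|D 2%N (z, 0, 0) v - D 2%N (z0, 0, 0) v| <= e * \prod_(i < 2) `|tnth v i|.
  move=> /(_ [tuple of k v :: [tuple of l w :: [tuple]]]).
  rewrite !D2E// !big_ord_recl big_ord0 mulr1 /= !(tnth_nth 0) /=.
  by rewrite kE lE.
clear v w Uz; near: z; exact: H.
Unshelve. all: by end_near. Qed.

End BilinearFamilies.

(** * Lower bounds for integrals of nonnegative functions *)

Section LowerIntegral.
Context d (T : measurableType d) (R : realType).
Local Open Scope ereal_scope.
Import HBNNSimple.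

(** The integral of a nonnegative function is the supremum of the integrals of
the simple functions below it, whether or not the function is measurable; to a
simple function below f on D1 one may add m times the indicator of D2. *)
Lemma ge0_integral_superadd (mu : {measure set T -> \bar R}) (D D1 D2 : set T)
    (f : T -> \bar R) (m : R) :
  measurable D2 -> mu D2 \is a fin_num -> D1 `<=` D -> D2 `<=` D ->
  D1 `&` D2 = set0 -> (forall x, D x -> 0 <= f x) ->
  (0 <= m)%R -> (forall x, D2 x -> m%:E <= f x) ->
  \int[mu]_(x in D1) f x + m%:E * mu D2 <= \int[mu]_(x in D) f x.
Proof.
move=> mD2 fin2 s1 s2 D12 f0 m0 mf.
rewrite !ge0_integralE//; last by move=> x /s1; exact: f0.
rewrite -leeBrDr ?fin_numM//; apply: ge_ereal_sup => _ /= [h hf <-].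
rewrite leeBrDr ?fin_numM//; apply: ereal_sup_ubound => /=.
pose g := scale_nnsfun (indic_nnsfun R mD2) m0.
exists (add_nnsfun h g).
  move=> x /=; have := hf x; rewrite /patch/= measurable_realfun.mindicE.
  have [/set_mem xD1|xD1] := boolP (x \in D1).
    have -> : x \in D2 = false.
      by apply/negP => /set_mem xD2; have : (D1 `&` D2) x by []; rewrite D12.
    by rewrite mulr0 addr0 mem_set//; exact: s1.
  rewrite lee_fin => h0; have -> : h x = 0%R by apply/eqP; rewrite eq_le h0/=.
  rewrite add0r; have [/set_mem xD2|xD2] := boolP (x \in D2).
    by rewrite mulr1 mem_set; [exact: mf|exact: s2].
  by rewrite mulr0; case: ifPn => // /set_mem/f0.
rewrite sintegralD//; congr (_ + _).
by rewrite sintegralrM sintegral_indic.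
Qed.

End LowerIntegral.

Section LengthIncrements.
Context {R : realType}.
Notation mu := (@lebesgue_measure R).

Definition running_integral (a : R) (f : R -> R) (s : R) : R :=
  fine (\int[mu]_(t in `[a, s]) (f t)%:E)%E.

Lemma running_integral_increment (a b : R) (f : R -> R) (t s m : R) :
  (forall u, u \in `[a, b] -> 0 <= f u) ->
  (\int[mu]_(t in `[a, b]) (f t)%:E < +oo)%E ->
  a <= t -> t <= s -> s <= b -> (forall u, u \in `]t, s[ -> m <= f u) ->
  m * (s - t) <= running_integral a f s - running_integral a f t.
Proof.
move=> f0 fin a_t ts sb mf.
(* Negative m are covered by taking the maximum of m and 0 at the end. *)
have incr (t' s' m' : R) : a <= t' -> t' <= s' -> s' <= b ->
    0 <= m' -> (forall u, u \in `]t', s'[ -> m' <= f u) ->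
    (\int[mu]_(u in `[a, t']) (f u)%:E + (m' * (s' - t'))%:E
      <= \int[mu]_(u in `[a, s']) (f u)%:E)%E.
  move=> at' ts' sb' m0 mf'.
  have -> : ((m' * (s' - t'))%:E = m'%:E * mu `]t', s'[)%E.
    rewrite lebesgue_measure_itv/= lte_fin; case: ltP => [_ //|st].
    by rewrite mule0 (_ : s' = t') ?subrr ?mulr0//; apply/eqP; rewrite eq_le st ts'.
  have fin' : mu `]t', s'[%classic \is a fin_num.
    by rewrite lebesgue_measure_itv/=; case: ifP.
  apply: ge0_integral_superadd => //.
  - by move=> u /=; rewrite !in_itv/= => /andP[-> /le_trans->].
  - move=> u /=; rewrite !in_itv/= => /andP[/ltW tu /ltW ->].
    by rewrite (le_trans at' tu).
  - rewrite -subset0 => u [/=]; rewrite !in_itv/= => /andP[_ ut] /andP[tu _].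
    by have := lt_le_trans tu ut; rewrite ltxx.
  - move=> u /=; rewrite in_itv/= => /andP[au us]; rewrite lee_fin f0// in_itv/= au.
    exact: le_trans us sb'.
have inc0 (t' s' : R) : a <= t' -> t' <= s' -> s' <= b ->
  (\int[mu]_(t in `[a, t']) (f t)%:E <= \int[mu]_(t in `[a, s']) (f t)%:E)%E.
  move=> ? ? ?; have := incr t' s' 0; rewrite mul0r adde0; apply => // u.
  rewrite in_itv/= => /andP[t'u us']; apply: f0; rewrite in_itv/=.
  by apply/andP; split; [apply: (le_trans _ (ltW t'u))|apply: (le_trans (ltW us'))].
have as_ : a <= s by exact: le_trans ts.
have finite (u : R) : a <= u -> u <= b ->
    (\int[mu]_(t in `[a, u]) (f t)%:E)%E \is a fin_num.
  move=> au ub; rewrite ge0_fin_numE.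
    exact: le_lt_trans (inc0 _ _ au ub (lexx b)) fin.
  apply: integral_ge0 => v /=; rewrite in_itv/= => /andP[av vu].
  by rewrite lee_fin f0// in_itv/= av (le_trans vu).
have fins := finite s as_ sb; have fint := finite t a_t (le_trans ts sb).
have st : 0 <= s - t by rewrite subr_ge0.
rewrite /running_integral; apply: (@le_trans _ _ (Num.max m 0 * (s - t))).
  by rewrite ler_wpM2r// le_max lexx.
rewrite lerBrDl -lee_fin EFinD !fineK//; apply: incr => //.
  by rewrite le_max lexx orbT.
move=> u uts; rewrite ge_max mf//=; apply: f0.
move: uts; rewrite !in_itv/= => /andP[tu us].
by apply/andP; split; [apply: (le_trans _ (ltW tu))|apply: (le_trans (ltW us))].
Qed.

End LengthIncrements.

(** * Real induction and trapped curves *)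

Section Trapping.
Context {R : realType}.

Lemma real_induction (a b : R) (P : R -> Prop) :
  a <= b -> P a ->
  (forall t, a <= t -> t < b -> P t -> \forall s \near t^'+, P s) ->
  (forall t, a < t -> t <= b -> (forall s, a <= s -> s < t -> P s) -> P t) ->
  P b.
Proof.
move=> ab Pa right left.
pose S := [set t | a <= t <= b /\ forall s, a <= s -> s <= t -> P s].
have Sa : S a.
  split=> [|s as_ sa]; first by rewrite lexx.
  by rewrite (_ : s = a)//; apply: le_anti; rewrite sa.
have supS : has_sup S by split; [exists a|exists b => t [/andP[]]].
set t := sup S.
have at_ : a <= t by exact: sup_upper_bound.
have tb : t <= b by apply: ge_sup => //; [exists a|move=> s [/andP[]]].
have Pbelow s : a <= s -> s < t -> P s.
  move=> as_ st; have e0 : 0 < t - s by rewrite subr_gt0.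
  have [u [_ Pu]] := sup_adherent e0 supS; rewrite subKr => su.
  by apply: Pu => //; exact: ltW.
have Pt : P t.
  by move: at_; rewrite le_eqVlt => /predU1P[<- //|at_]; exact: left.
move: tb; rewrite le_eqVlt => /predU1P[<- //|tb].
have [e /= e0 He] := right t at_ tb Pt.
pose u := Num.min b (t + e / 2).
have tu : t < u by rewrite lt_min tb ltrDl divr_gt0.
suff : S u by move=> /(sup_upper_bound supS); rewrite leNgt tu.
split; first by rewrite ge_min lexx (le_trans at_ (ltW tu)).
move=> s as_; rewrite le_min => /andP[_ su].
have [st|ts|->//] := ltgtP s t; first exact: Pbelow.
apply: He => //=; rewrite distrC gtr0_norm ?subr_gt0//.
rewrite ltrBlDl (le_lt_trans su)// ltrD2l gtr_pMr// invf_lt1// ltr1n//.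
Qed.

(** Read L t as the length of c on [a, t].  By real induction the curve stays in
W and delta |psi (c t) - psi (c a)| <= L t + e (t - a), which stays below r for
a suitable slack e.  Points satisfying the bound lie in N, so a limit of such
points lies in the closure of N, hence in W, where psi is continuous: this is
what allows the induction to pass to limits. *)
Lemma trapped_curve (X : topologicalType) (V : normedModType R) (c : R -> X)
    (a b : R) (psi : X -> V) (W N : set X) (delta r : R) (L : R -> R) :
  a <= b -> {within `[a, b], continuous c} ->
  open W -> closure N `<=` W -> W (c a) -> 
  (forall u, W u -> {for u, continuous psi}) ->
  (forall u, W u -> delta * `|psi u - psi (c a)| < r -> N u) ->
  L a = 0 -> (forall s t, a <= s -> s <= t -> t <= b -> L s <= L t) ->
  0 <= delta -> L b < r ->
  (forall t, a <= t -> t < b -> W (c t) -> delta * `|psi (c t) - psi (c a)| < r ->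
    forall e, 0 < e -> \forall s \near t^'+,
      delta * `|psi (c s) - psi (c t)| <= L s - L t + e * (s - t)) ->
  W (c b).
Proof.
move=> ab cc oW NW Wa psic psiN La Lmono d0 Lb loc.
have ba : 0 < b - a + 1 by rewrite ltr_wpDl// subr_ge0.
(* The denominator b - a + 1 covers the case a = b. *)
pose e := (r - L b) / (b - a + 1).
have e0 : 0 < e by rewrite divr_gt0// subr_gt0.
have small s : a <= s -> s <= b -> L s + e * (s - a) < r.
  move=> as_ sb; apply: (@le_lt_trans _ _ (L b + e * (b - a))).
    by rewrite lerD//; [exact: Lmono|rewrite ler_wpM2l ?lerD2r// ltW].
  by rewrite -ltrBrDl /e mulrAC ltr_pdivrMr// ltr_pM2l ?subr_gt0// ltrDl.
pose P t := t <= b -> W (c t) /\ delta * `|psi (c t) - psi (c a)| <= L t + e * (t - a).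
have cw t : a <= t -> t <= b -> c x @[x --> within `[a, b] (nbhs t)] --> c t.
  by move=> at_ tb; move/subspace_continuousP : cc; apply; rewrite /= in_itv/= at_.
suff : P b by move=> /(_ (lexx b))[].
apply: (real_induction (P := P) ab).
- by move=> _; rewrite !subrr normr0 !mulr0 La addr0.
- move=> t at_ tb /(_ (ltW tb))[Wt Pt].
  have Pr := le_lt_trans Pt (small t at_ (ltW tb)).
  have nW : nbhs (c t) W by exact: open_nbhs_nbhs.
  have Ws : \forall s \near t, `[a, b]%classic s -> W (c s) := cw t at_ (ltW tb) _ nW.
  have {}Ws : \forall s \near t^'+, `[a, b]%classic s -> W (c s) by exact: cvg_within.
  have ls := loc t at_ tb Wt Pr e e0.
  near=> s => sb.
  have ts : t < s by near: s; exact: nbhs_right_gt.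
  split.
    have : `[a, b]%classic s -> W (c s).
      by near: s.
    by apply; rewrite /= in_itv/= sb (le_trans at_ (ltW ts)).
  have H : delta * `|psi (c s) - psi (c t)| <= L s - L t + e * (s - t) by near: s.
  have H2 : `|psi (c s) - psi (c a)| <=
      `|psi (c s) - psi (c t)| + `|psi (c t) - psi (c a)|.
    by rewrite -[X in `|X|](subrKA (psi (c t))) ler_normD.
  apply: (le_trans (ler_wpM2l d0 H2)); rewrite mulrDr.
  apply: (le_trans (lerD H Pt)); rewrite le_eqVlt; apply/orP; left; apply/eqP; ring.
- move=> t at_ tb Pt _.
  have PF : ProperFilter (t^'-) by exact: at_left_proper_filter.
  have ct : c x @[x --> t^'-] --> c t.
    move=> A nA.
    have cA : \forall s \near t, `[a, b]%classic s -> A (c s) := cw t (ltW at_) tb _ nA.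
    have {}cA : \forall s \near t^'-, `[a, b]%classic s -> A (c s) by exact: cvg_within.
    suff : \forall s \near t^'-, A (c s) by [].
    near=> s; have : `[a, b]%classic s -> A (c s) by near: s.
    apply; rewrite /= in_itv/=; apply/andP; split.
      by near: s; apply: nbhs_left_ge.
    by apply: le_trans tb; near: s; apply: nbhs_left_le.
  have N' : \forall s \near t^'-, N (c s).
    near=> s.
    have as_ : a <= s by near: s; apply: nbhs_left_ge.
    have st : s < t by near: s; apply: nbhs_left_lt.
    have sb : s <= b by rewrite (le_trans (ltW st)).
    have [Ws Ps] := Pt s as_ st sb.
    by apply: psiN => //; exact: le_lt_trans Ps (small s as_ sb).
  have Wt : W (c t).
    apply: NW; apply: (@closed_cvg _ _ (t^'-) _ c (closure N)) ct.
      exact: closed_closure.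
    by apply: filterS N' => s; exact: subset_closure.
  split => //.
  have psit : `|psi (c s) - psi (c a)| @[s --> t^'-] --> `|psi (c t) - psi (c a)|.
    apply: cvg_norm; apply: cvgB; last exact: cvg_cst.
    exact: cvg_comp ct (psic _ Wt).
  have dpsit : delta * `|psi (c s) - psi (c a)| @[s --> t^'-]
      --> delta * `|psi (c t) - psi (c a)|.
    by apply: cvgM => //; exact: cvg_cst.
  rewrite -(cvg_lim _ dpsit)//; apply: limr_le.
    by apply/cvg_ex; eexists; exact: dpsit.
  near=> s.
  have as_ : a <= s by near: s; apply: nbhs_left_ge.
  have st : s < t by near: s; apply: nbhs_left_lt.
  have sb : s <= b by rewrite (le_trans (ltW st)).
  have [_ Ps] := Pt s as_ st sb.
  apply: (le_trans Ps); rewrite lerD//; first exact: Lmono (ltW st) tb.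
  by rewrite ler_wpM2l ?lerD2r// ltW.
Unshelve. all: by end_near. Qed.

End Trapping.

(** * Curves and maps in charts *)

Section Charts.
Context {R : realType} {E : completeNormedModType R}.
Implicit Types M N : banachManifoldType E.

Lemma chart_invK M (x : M) z : chart_img x z ->
  chart_dom x (chart_inv x z) /\ chart x (chart_inv x z) = z.
Proof. by move=> [u ux <-]; rewrite chartK ?inE. Qed.

Lemma nbhs_chart M (x u : M) (A : set M) : chart_dom x u -> nbhs u A ->
  nbhs (chart x u) (chart x @` (A `&` chart_dom x)).
Proof.
move=> xu uA.
have ux : chart_img x (chart x u) by exists u.
have nz : nbhs (chart x u) (chart_img x).
  by apply: open_nbhs_nbhs; split => //; exact: chart_img_open.
have ci : chart_inv x z @[z --> chart x u] --> u.
  have /(_ (mem_set ux)) := @chart_inv_continuous R E M x (chart x u).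
  by rewrite /continuous_at chartK ?inE.
have Az : \forall z \near chart x u, A (chart_inv x z) := ci _ uA.
near=> z.
have [zx zE] : chart_dom x (chart_inv x z) /\ chart x (chart_inv x z) = z.
  by apply: chart_invK; near: z.
by exists (chart_inv x z) => //; split => //; near: z.
Unshelve. all: by end_near. Qed.

Lemma transition_C1 M (x y u : M) : chart_dom x u -> chart_dom y u ->
  C1_at (chart y \o chart_inv x) (chart x u).
Proof.
move=> xu yu; apply: (smooth_on_C1 (chart_transition x y)).
rewrite setIC; apply: nbhs_chart => //.
by apply: open_nbhs_nbhs; split => //; exact: chart_dom_open.
Qed.

Lemma smooth_map_on_C1 M N (U : set M) (f : M -> N) (x u : M) (y : N) :
  smooth_map_on U f -> open U -> U u -> chart_dom x u -> chart_dom y (f u) ->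
  C1_at (chart y \o f \o chart_inv x) (chart x u).
Proof.
move=> [fc fs] oU Uu xu yu; apply: (smooth_on_C1 (fs x y)).
rewrite setIAC; apply: nbhs_chart => //; apply: filterI.
  by apply: open_nbhs_nbhs.
have fcu : {for u, continuous f} by apply: fc; rewrite inE.
by apply: fcu; apply: open_nbhs_nbhs; split => //; exact: chart_dom_open.
Qed.

Lemma smooth_curve_on_C1 M (J : set R) (c : R -> M) (x : M) (t : R) :
  smooth_curve_on J c -> open J -> J t -> chart_dom x (c t) ->
  C1_at (chart x \o c : R^o -> E) t.
Proof.
move=> [cc cs] oJ Jt xct; apply: (smooth_on_C1 (cs x)).
apply: filterI; first exact: open_nbhs_nbhs.
have fcu : {for t, continuous c} by apply: cc; rewrite inE.
by apply: fcu; apply: open_nbhs_nbhs; split => //; exact: chart_dom_open.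
Qed.

Lemma near_chartK M (c : R -> M) (x : M) (t : R) :
  {for t, continuous c} -> chart_dom x (c t) ->
  \forall s \near t, chart_inv x (chart x (c s)) = c s.
Proof.
move=> cc xct.
have : \forall s \near t, chart_dom x (c s).
  by apply: cc; apply: open_nbhs_nbhs; split => //; exact: chart_dom_open.
by apply: filterS => s xcs; rewrite chartK ?inE.
Qed.

(** Stated after applying a covector field F, since the two velocities belong to
tangent spaces at points that are only propositionally equal. *)
Lemma velocity_near_eq M (F : covector_field M) (c e : R -> M) (s : R) :
  (\forall t \near s, c t = e t) ->
  F (c s) (velocity c s) = F (e s) (velocity e s).
Proof.
move=> ce; rewrite /velocity.
have -> : derive1 (chart (c s) \o c) s = derive1 (chart (c s) \o e) s.
  rewrite !derive1E; apply: near_eq_derive.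
  by apply: filterS ce => t /= ->.
by rewrite (nbhs_singleton ce).
Qed.

(** Both sides are the value of g on the velocity of p o e.  On the left it is
the image of the velocity of e under the tangent map of p; on the right it is
obtained from the velocity in the chart at x0 by a change of charts. *)
Lemma pullback2_velocity M N (p : M -> N) (g : bilinear_field N) (U : set M)
    (e : R -> M) (x0 : N) (s : R) :
  smooth_map_on U p -> open U -> U (e s) -> {for s, continuous e} ->
  C1_at (chart (e s) \o e : R^o -> E) s -> chart_dom x0 (p (e s)) ->
  let v := 'd (chart x0 \o p \o e : R^o -> E) s 1 in
  pullback2 p g (velocity e s) (velocity e s) =
  local2 g x0 (chart x0 (p (e s))) v v.
Proof.
move=> ps oU Us ec eC x0s /=.
set u := e s in Us eC x0s *.
have ud : chart_dom u u by exact: chart_dom_base.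
have pud : chart_dom (p u) (p u) by exact: chart_dom_base.
have de := nbhs_singleton eC.1.
have dp (y : N) : chart_dom y (p u) ->
    differentiable (chart y \o p \o chart_inv u) (chart u u).
  by move=> yu; have [/nbhs_singleton] := smooth_map_on_C1 ps oU Us ud yu.
have pe (y : N) : chart_dom y (p u) ->
    differentiable (chart y \o p \o e : R^o -> E) s /\
    'd (chart y \o p \o e : R^o -> E) s 1 =
    'd (chart y \o p \o chart_inv u) (chart u u) ('d (chart u \o e : R^o -> E) s 1).
  move=> yu; have dpe := differentiable_comp de (dp y yu).
  have E1 : \forall t \near (s : R^o), ((chart y \o p \o chart_inv u) \o (chart u \o e)) t
       = (chart y \o p \o e) t.
    by have := near_chartK ec ud; apply: filterS => t /= ->.
  have [d1 d2] := near_eq_diff E1 dpe.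
  by split => //; rewrite d2 (diff_comp de (dp y yu)).
have pc : {for s, continuous (p \o e)}.
  apply: continuous_comp => //; have [pc _] := ps.
  by apply: pc; rewrite inE.
have E2 : \forall t \near (s : R^o),
    ((chart (p u) \o chart_inv x0) \o (chart x0 \o p \o e)) t = (chart (p u) \o p \o e) t.
  by have := near_chartK pc x0s; apply: filterS => t /= ->.
have [d3 _] := pe x0 x0s.
have [/nbhs_singleton dt _] := transition_C1 x0s pud.
have [_ d4] := near_eq_diff E2 (differentiable_comp d3 dt).
rewrite /local2 /chart_vector chartK ?inE//.
rewrite /pullback2 /tangent_map.
have -> : velocity e s = 'd (chart u \o e : R^o -> E) s 1.
  by rewrite /velocity derive1E'.
have [_ <-] := pe (p u) pud.
by rewrite d4 (diff_comp d3 dt).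
Qed.

End Charts.

(** * Bounds for strong metrics and magnetic Finsler metrics *)

Section Metric.
Context {R : realType} {E : completeNormedModType R}.
Implicit Types M N : banachManifoldType E.

Lemma scalarZ (f : E -> R) t v : scalar f -> f (t *: v) = t * f v.
Proof.
move=> fl; have f0 : f 0 = 0.
  by have := fl (-1) 0 0; rewrite scaler0 addr0 mulN1r addNr.
by have := fl t v 0; rewrite !addr0 f0 addr0.
Qed.

Lemma riem_normZ M (g : bilinear_field M) (x : M) t (v : tangent x) :
  (forall v, scalar (g x v)) -> (forall w, scalar (g x ^~ w)) ->
  riem_norm g (t *: v) = `|t| * riem_norm g v.
Proof.
move=> gl gr; rewrite /riem_norm (scalarZ _ _ (gl _)) (scalarZ _ _ (gr _)).
by rewrite mulrA -expr2 sqrtrM ?sqr_ge0// sqrtr_sqr.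
Qed.

Lemma chart_chart_inv_diff M (x : M) v :
  'd (chart x \o chart_inv x) (chart x x) v = v.
Proof.
have E1 : \forall z \near chart x x, id z = (chart x \o chart_inv x) z.
  have : nbhs (chart x x) (chart_img x).
    apply: open_nbhs_nbhs; split; first exact: chart_img_open.
    by exists x => //; exact: chart_dom_base.
  by apply: filterS => z /chart_invK[_ /= ->].
have id_diff := is_diff_id (chart x x : E).
have [_ ->] := near_eq_diff E1 ex_diff; by rewrite diff_val.
Qed.

(** At x0 the bound, with a constant e, says that the unit ball of E contains a
ball for g.  The representing forms vary continuously for the operator norm, so
near x0 they are at least e ^+ 2 / 2 times the square of the norm. *)
Lemma strong_metric_lower_bound M (g : bilinear_field M) (x0 : M) :
  riemannian_metric g -> strong_metric g ->
  exists2 m : R, 0 < m & \forall z \near chart x0 x0, forall v,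
    m * `|v| <= Num.sqrt (local2 g x0 z v v).
Proof.
move=> [[gl gr gs] gsym gpos] gstrong.
have [e e0 He] : exists2 e : R, 0 < e &
    forall v, e * `|v| <= riem_norm g (v : tangent x0).
  have [+ _] := gstrong x0 0 (ball 0 1).
  move=> /(_ (nbhsx_ballx _ _ _))[//|e e0 He]; exists e => // v.
  have [->|v0] := eqVneq v 0; first by rewrite normr0 mulr0 sqrtr_ge0.
  have nv0 : 0 < `|v| by rewrite normr_gt0.
  rewrite leNgt; apply/negP => Hlt.
  have : ball (0 : E) 1 (`|v|^-1 *: v).
    apply: He => /=; rewrite subr0 riem_normZ//.
    by rewrite normfV normr_id mulrC ltr_pdivrMr.
  by rewrite -ball_normE /= sub0r normrN normrZ normfV normr_id mulVf ?ltxx ?gt_eqF.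
exists (Num.sqrt (e ^+ 2 / 2)); first by rewrite sqrtr_gt0 divr_gt0// exprn_gt0.
have bl z v : linear (local2 g x0 z v).
  by move=> t u w; rewrite /local2 /chart_vector linearP gl.
have br z w : linear (local2 g x0 z ^~ w).
  by move=> t u v; rewrite /local2 /chart_vector linearP gr.
have nx0 : nbhs (chart x0 x0) (chart_img x0).
  apply: open_nbhs_nbhs; split; first exact: chart_img_open.
  by exists x0 => //; exact: chart_dom_base.
have e2 : 0 < e ^+ 2 / 2 by rewrite divr_gt0// exprn_gt0.
have := smooth_bilinear_family_cts (fun z v _ => bl z v)
  (fun z w _ => br z w) (gs x0) nx0 e2.
apply: filterS => z Hz v; have := Hz v v.
have -> : local2 g x0 (chart x0 x0) v v = g x0 v v.
  rewrite /local2 /chart_vector chartK ?inE; last exact: chart_dom_base.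
  by rewrite chart_chart_inv_diff.
have gvv : e ^+ 2 * `|v| ^+ 2 <= g x0 v v.
  have g0 : 0 <= g x0 v v.
    have [->|/gpos/ltW//] := eqVneq v 0.
    by rewrite -(scale0r (0 : E)) (scalarZ _ _ (gl _ _)) mul0r.
  rewrite -exprMn -(sqr_sqrtr g0) ler_sqr ?nnegrE ?sqrtr_ge0 ?mulr_ge0 ?(ltW e0)//.
rewrite -expr2 => Hz'.
have lz : e ^+ 2 / 2 * `|v| ^+ 2 <= local2 g x0 z v v.
  move: Hz'; rewrite distrC => /(le_trans (ler_norm _)); lra.
by rewrite -[`|v|]normr_id -sqrtr_sqr -sqrtrM ?(ltW e2)// ler_wsqrtr.
Qed.

Lemma pullback2_scalar M N (p : M -> N) (g : bilinear_field N) :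
  smooth_bilinear_field g ->
  (forall x v, scalar (@pullback2 _ _ _ _ p g x v)) /\
  (forall x w, scalar (@pullback2 _ _ _ _ p g x ^~ w)).
Proof.
move=> [gl gr _]; split=> x w t u v; rewrite /pullback2 /tangent_map linearP.
  exact: gl.
exact: gr.
Qed.

(** Rescale v to g-norm 1.  On a vector of g-norm 0 the covector vanishes, since
otherwise multiples of that vector would make the dual norm infinite. *)
Lemma dual_norm_bound M (g : bilinear_field M) (alpha : covector_field M) (n : R) :
  (forall x v, scalar (g x v)) -> (forall x w, scalar (g x ^~ w)) ->
  (forall x, scalar (alpha x)) -> (sup_norm g alpha <= n%:E)%E ->
  forall x (v : tangent x), `|alpha x v| <= n * riem_norm g v.
Proof.
move=> gl gr al supn x v.
have unit (w : tangent x) : riem_norm g w <= 1 -> `|alpha x w| <= n.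
  move=> w1; rewrite -lee_fin; apply: le_trans supn.
  apply: (@le_trans _ _ (dual_norm g alpha x)); apply: ereal_sup_ubound.
    by exists w.
  by exists x.
have N0 : 0 <= riem_norm g v by exact: sqrtr_ge0.
have [n0|Npos] := leP (riem_norm g v) 0.
  have nv : riem_norm g v = 0 by apply/le_anti; rewrite n0.
  rewrite nv mulr0 leNgt; apply/negP => av.
  have n1 : 0 <= n by apply: le_trans (unit v _); rewrite ?nv.
  have := unit ((n + 1) / `|alpha x v| *: v).
  rewrite riem_normZ// nv mulr0 => /(_ ler01).
  rewrite (scalarZ _ _ (al x)) normrM ger0_norm; last by rewrite divr_ge0// addr_ge0.
  by rewrite divfK ?gt_eqF// leNgt ltrDl ltr01.
have := unit ((riem_norm g v)^-1 *: v).
rewrite riem_normZ// ger0_norm ?invr_ge0// mulVf ?gt_eqF// => /(_ (lexx _)).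
rewrite (scalarZ _ _ (al x)) normrM ger0_norm ?invr_ge0//.
by rewrite mulrC ler_pdivrMr.
Qed.

Lemma half_sqr_lt_fin (s : \bar R) (kappa : R) : (0 <= s)%E ->
  ((2^-1)%:E * s ^+ 2 < kappa%:E)%E ->
  exists2 n : R, s = n%:E & n < Num.sqrt (2 * kappa).
Proof.
case: s => [n|_|//].
- rewrite lee_fin => n0; rewrite -EFin_expe -EFinM lte_fin => nk; exists n => //.
  rewrite -[n]ger0_norm// -sqrtr_sqr ltr_sqrt; last first.
    by have := sqr_ge0 n; lra.
  lra.
- by rewrite expe2 mulyy mulry gtr0_sg ?mul1e.
Qed.

Lemma magnetic_finsler_bound M (g : bilinear_field M) (alpha : covector_field M)
    (kappa : R) :
  M ->
  (forall x v, scalar (g x v)) -> (forall x w, scalar (g x ^~ w)) ->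
  (forall x, scalar (alpha x)) ->
  ((2^-1)%:E * sup_norm g alpha ^+ 2 < kappa%:E)%E ->
  exists2 delta : R, 0 < delta &
    forall x v, delta * riem_norm g v <= magnetic_finsler g alpha kappa (x := x) v.
Proof.
move=> x0 gl gr al lt.
have s0 : (0 <= sup_norm g alpha)%E.
  apply: (@le_trans _ _ (dual_norm g alpha x0)).
    apply: (@le_trans _ _ (`|alpha x0 0|%R)%:E); first by rewrite lee_fin.
    apply: ereal_sup_ubound; exists 0 => //=.
    by rewrite -(scale0r (0 : E)) riem_normZ// normr0 mul0r.
  by apply: ereal_sup_ubound; exists x0.
have [n sn nk] := half_sqr_lt_fin s0 lt.
exists (Num.sqrt (2 * kappa) - n); first by rewrite subr_gt0.
move=> x v; rewrite /magnetic_finsler mulrBl lerD2l lerN2.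
apply: (le_trans (ler_norm _)); apply: dual_norm_bound => //.
by rewrite sn.
Qed.

End Metric.

(** * Increments of the length along piecewise smooth curves *)

Section Lengths.
Context {R : realType} {E : completeNormedModType R}.
Implicit Types M N : banachManifoldType E.

Lemma itv_partition_piece (a b t : R) (s : seq R) :
  itv_partition a b s -> a <= t -> t < b ->
  exists2 i, (i < size s)%N & nth b (a :: s) i <= t < nth b s i.
Proof.
elim: s a => [|u s IH] a [/= ps lasts] a_t tb.
  by move: lasts => /eqP ab; move: (le_lt_trans a_t tb); rewrite ab ltxx.
move/andP: ps => [au pus].
have [tu|ut] := ltP t u; first by exists 0%N; rewrite //= a_t.
have [|i si Hi] := IH u _ ut tb; first by split.
by exists i.+1.
Qed.

Lemma piecewise_smooth_right M (a b : R) (c : R -> M) (t : R) :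
  piecewise_smooth a b c -> a <= t -> t < b ->
  exists J e u, [/\ open J, J t, smooth_curve_on J e, t < u &
    forall s, t <= s -> s <= u -> c s = e s].
Proof.
move=> [_ [s ps pieces]] a_t tb.
have [i si /andP[it ti]] := itv_partition_piece ps a_t tb.
have [J [e [oJ IJ sme ce]]] := pieces i si.
exists J, e, (nth b s i); split => //.
  by apply: IJ; rewrite /= in_itv/= it ltW.
by move=> v tv vu; apply: ce; rewrite in_itv/= vu (le_trans it tv).
Qed.

(** With D := delta m |(psi o e)' t|, for psi the map p read in the chart at x0,
the first bound is differentiability of psi o e at t and the second the
continuity of its derivative. *)
Lemma finsler_local_increment M N (p : M -> N) (g : bilinear_field N)
    (F : covector_field M) (U : set M) (J : set R) (e : R -> M) (x0 : N)
    (delta m t eps : R) :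
  0 < delta -> 0 < m ->
  (forall x v, delta * riem_norm (pullback2 p g) v <= F x v) ->
  smooth_map_on U p -> open U ->
  open J -> smooth_curve_on J e -> J t -> U (e t) -> chart_dom x0 (p (e t)) ->
  (\forall z \near chart x0 (p (e t)), forall v,
    m * `|v| <= Num.sqrt (local2 g x0 z v v)) ->
  0 < eps ->
  exists D, \forall s \near t,
    delta * m * `|chart x0 (p (e s)) - chart x0 (p (e t))| <= (D + eps) * `|s - t| /\
    D - eps <= F (e s) (velocity e s).
Proof.
move=> d0 m0 Fge ps oU oJ sme Jt Ut x0t mz eps0.
have ec s : J s -> {for s, continuous e}.
  by move=> Js; have [ec _] := sme; apply: ec; rewrite inE.
pose gam : R^o -> E := chart x0 \o p \o e.
have pc : {for e t, continuous p} by have [pc _] := ps; apply: pc; rewrite inE.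
have pec : {for t, continuous (p \o e)} by apply: continuous_comp pc; exact: ec.
have ud := chart_dom_base (e t).
have gamC : C1_at gam t.
  have eC := smooth_curve_on_C1 sme oJ Jt ud.
  have pC := smooth_map_on_C1 ps oU Ut ud x0t.
  apply: C1_near_eq (C1_comp eC pC).
  by have := near_chartK (ec t Jt) ud; apply: filterS => s /= ->.
have dm0 : 0 < delta * m by rewrite mulr_gt0.
have e1 : 0 < eps / (delta * m) by rewrite divr_gt0.
exists (delta * m * `|'d gam t 1|).
have bounds := C1_curve_bounds gamC e1.
have gamc : {for t, continuous gam} := C1_continuous gamC.
have mz' : \forall s \near t, forall v, m * `|v| <= Num.sqrt (local2 g x0 (gam s) v v).
  exact: gamc mz.
have Js : \forall s \near t, J s by apply: open_nbhs_nbhs.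
have Us : \forall s \near t, U (e s) by apply: (ec t Jt); apply: open_nbhs_nbhs.
have x0s : \forall s \near t, chart_dom x0 (p (e s)).
  by apply: pec; apply: open_nbhs_nbhs; split => //; exact: chart_dom_open.
near=> s.
have [b1 b2 b3] : [/\ `|gam s - gam t| <= (`|'d gam t 1| + eps / (delta * m)) * `|s - t|,
    `|'d gam t 1| - eps / (delta * m) <= `|'d gam s 1| & differentiable gam s].
  by near: s.
have epsE : eps = delta * m * (eps / (delta * m)) by rewrite mulrC divfK ?gt_eqF.
split.
  by rewrite [in leRHS]epsE -mulrDr -[leRHS]mulrA ler_pM2l.
have Hs : J s by near: s.
have Hx0 : chart_dom x0 (p (e s)) by near: s.
have HU : U (e s) by near: s.
have Hm : forall v, m * `|v| <= Num.sqrt (local2 g x0 (gam s) v v) by near: s.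
apply: le_trans (Fge _ _).
have eCs := smooth_curve_on_C1 sme oJ Hs (chart_dom_base (e s)).
rewrite /riem_norm (pullback2_velocity g ps oU HU (ec s Hs) eCs Hx0).
apply: (@le_trans _ _ (delta * (m * `|'d gam s 1|))); last by rewrite ler_pM2l.
by rewrite mulrA [in leLHS]epsE -mulrBr ler_pM2l.
Unshelve. all: by end_near. Qed.

End Lengths.

(** * Regularity of half-Lie groups *)

Section Regularity.
Context {R : realType} {E : completeNormedModType R}.

(** The usual argument for topological groups: if N I is contained in W, for
neighbourhoods N of x and I of 1, then so is the closure of N.  For q in that
closure, the z with z^-1 q in I form a neighbourhood of q, which meets N, and
q = z (z^-1 q). *)
Lemma half_lie_group_regular (G : halfLieGroupType E) (x : G) (W : set G) :
  nbhs x W -> exists2 N : set G, nbhs x N & closure N `<=` W.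
Proof.
move=> xW; have := @mulg_continuous R E G (x, 1%g).
rewrite /continuous_at /= mulg1 => /(_ _ xW)[[N I] /= [xN I1] NI].
exists N => // q qN.
have qI : nbhs q [set z : G | I (z^-1 * q)%g].
  have -> : nbhs q [set z : G | I (z^-1 * q)%g] =
    nbhs q ((fun z : G => (z^-1 * q)%g) @^-1` I) by [].
  have c1 : (z^-1, q)%g @[z --> q] --> (q^-1, q)%g.
    by apply: cvg_pair; [exact: invg_continuous|exact: cvg_cst].
  have c2 := @mulg_continuous R E G (q^-1, q)%g.
  have c3 : (z^-1 * q)%g @[z --> q] --> (q^-1 * q)%g by exact: cvg_comp c1 c2.
  by apply: c3; rewrite mulVg.
have [z [zN zI]] := qN _ qI.
have := NI (z, (z^-1 * q)%g); rewrite /= mulgA mulgV mul1g; apply.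
by split.
Qed.

End Regularity.

(** * Non-degeneracy of the geodesic distance *)

Section Nondegeneracy.
Context {R : realType} {E : completeNormedModType R}.

(** Curves from x shorter than r are trapped in a neighbourhood W of x.  Removing
y from W keeps it open, since manifolds are Hausdorff, and turns trapping into
a contradiction for curves that end at y. *)
Lemma finsler_length_lower_bound (G : halfLieGroupType E) (N : banachManifoldType E)
    (p : G -> N) (g : bilinear_field N) (F : covector_field G) (delta : R) (x y : G) :
  local_diffeomorphism p -> riemannian_metric g -> strong_metric g ->
  0 < delta -> (forall u v, delta * riem_norm (pullback2 p g) v <= F u v) ->
  x <> y ->
  exists2 r : R, 0 < r & forall a b c, a <= b -> piecewise_smooth a b c ->
    c a = x -> c b = y -> (r%:E <= finsler_length F a b c)%E.
Proof.
move=> pdiff grm gst d0 Fge xy.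
have F0 u v : 0 <= F u v by apply: le_trans (Fge u v); rewrite mulr_ge0 ?sqrtr_ge0 ?ltW.
have [U [h [oU Ux opU ps [hs hK]]]] := pdiff x.
have pc u : U u -> {for u, continuous p}.
  by move=> Uu; have [pc _] := ps; apply: pc; rewrite inE.
set x0 := p x; have x0d : chart_dom x0 x0 by exact: chart_dom_base.
have [m m0 mz] := strong_metric_lower_bound x0 grm gst.
pose W := [set u | U u /\ chart_dom x0 (p u) /\ u <> y].
have oW : open W.
  rewrite openE => u [Uu [x0u uy]]; rewrite /interior.
  apply: filterI; first exact: open_nbhs_nbhs.
  apply: filterI.
    by apply: (pc u Uu); apply: open_nbhs_nbhs; split => //; exact: chart_dom_open.
  have cy : closed [set y].
    exact/accessible_closed_set1/hausdorff_accessible/manifold_hausdorff.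
  by apply: open_nbhs_nbhs; split => //; exact: closed_openC.
have Wx : W x by [].
have [V xV VW] := half_lie_group_regular (open_nbhs_nbhs (conj oW Wx)).
pose psi u := chart x0 (p u).
have psic u : W u -> {for u, continuous psi}.
  move=> [Uu [x0u _]]; apply: (@continuous_comp _ _ _ p (chart x0)); first exact: pc.
  by apply: chart_continuous; rewrite inE.
have hx : h x0 = x by apply: hK; rewrite inE.
have nearV : \forall z \near psi x, V (h (chart_inv x0 z)).
  have c1 : chart_inv x0 z @[z --> psi x] --> x0.
    have /(_ (mem_set _)) := @chart_inv_continuous R E N x0 (psi x).
    rewrite /continuous_at chartK ?inE//; apply.
    by exists x0.
  have c2 : h z @[z --> x0] --> x.
    have [hc _] := hs; rewrite -[X in _ --> X]hx; apply: hc; rewrite inE.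
    by exists x.
  have c3 : h (chart_inv x0 z) @[z --> psi x] --> x by exact: cvg_comp c1 c2.
  exact: c3.
have /nbhs_normP[rho /= rho0 Hrho] : \forall z \near psi x, V (h (chart_inv x0 z)) /\
    \forall z' \near z, forall v, m * `|v| <= Num.sqrt (local2 g x0 z' v v).
  by apply: filterI => //; exact: near_join.
have dm0 : 0 < delta * m by rewrite mulr_gt0.
have ballP u : delta * m * `|psi u - psi x| < delta * m * rho ->
    ball_ [eta Num.norm] (psi x) rho (psi u).
  by rewrite ltr_pM2l//= distrC.
exists (delta * m * rho); first by rewrite mulr_gt0.
move=> a b c ab cps ca cb; rewrite leNgt; apply/negP => short.
pose f t := F (c t) (velocity c t).
have fin : (\int[lebesgue_measure]_(t in `[a, b]) (f t)%:E < +oo)%E.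
  by apply: (lt_trans short); rewrite ltry.
have incr := running_integral_increment (fun t _ => F0 (c t) (velocity c t)) fin.
suff : W (c b) by rewrite cb => -[_ [_]].
apply: (trapped_curve (a := a) (b := b) (c := c) (psi := psi) (W := W)
  (N := V) (delta := delta * m)
  (r := delta * m * rho) (L := running_integral a f)) => //.
- exact: cps.1.
- by rewrite ca.
- rewrite ca => u [Uu [x0u _]] /ballP/Hrho[].
  by rewrite /psi chartK ?inE// hK ?inE.
- by rewrite /running_integral set_itv1 integral_set1.
- move=> s t as_ st tb; rewrite -subr_ge0 -[leLHS](mul0r (t - s)).
  by apply: incr.
- exact: ltW.
- rewrite -lte_fin /running_integral fineK//; rewrite ge0_fin_numE//.
  by apply: integral_ge0 => t _; rewrite lee_fin F0.
move=> t at_ tb Wt; rewrite ca => /ballP/Hrho[_ mzt] eps eps0.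
have [J [e [u [oJ Jt sme tu ce]]]] := piecewise_smooth_right cps at_ tb.
have cet : c t = e t by apply: ce => //; exact: ltW.
have [Ut [x0t _]] := Wt; rewrite /psi cet in Ut x0t mzt *.
(* One half of eps for the displacement of the curve, one for its length. *)
have eps2 : 0 < eps / 2 by rewrite divr_gt0.
have [D /nbhs_normP[eta /= eta0 Heta]] :=
  finsler_local_increment d0 m0 Fge ps oU oJ sme Jt Ut x0t mzt eps2.
near=> s.
have ts : t < s by near: s; exact: nbhs_right_gt.
have su : s < u by near: s; exact: nbhs_right_lt.
have sb : s < b by near: s; exact: nbhs_right_lt.
have seta : s < t + eta by near: s; apply: nbhs_right_lt; rewrite ltrDl.
have inball v : t < v -> v <= s -> ball_ [eta Num.norm] t eta v.
  move=> tv vs; rewrite /= distrC gtr0_norm ?subr_gt0// ltrBlDl.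
  exact: le_lt_trans vs seta.
rewrite (ce s (ltW ts) (ltW su)).
have [H1 _] := Heta s (inball s ts (lexx s)).
have H2 : (D - eps / 2) * (s - t) <= running_integral a f s - running_integral a f t.
  apply: (incr _ _ _ at_ (ltW ts) (ltW sb)).
  move=> v; rewrite in_itv/= => /andP[tv vs].
  have [_] := Heta v (inball v tv (ltW vs)).
  rewrite /f (velocity_near_eq F (c := c) (e := e))//.
  near=> w; apply: ce; apply: ltW; near: w.
    exact: lt_nbhsr.
  by apply: lt_nbhsl; exact: lt_trans su.
apply: (le_trans H1); rewrite gtr0_norm ?subr_gt0//.
have -> : (D + eps / 2) * (s - t) = (D - eps / 2) * (s - t) + eps * (s - t) by field.
by rewrite lerD2r.
Unshelve. all: by end_near. Qed.

Lemma geodesic_distance_ge0 (M : banachManifoldType E) (F : covector_field M) (x y : M) :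
  (forall u v, 0 <= F u v) -> (0 <= geodesic_distance F x y)%E.
Proof.
move=> F0; apply: le_ereal_inf_tmp => _ [a [b [c [_ _ _ _ ->]]]].
by apply: integral_ge0 => t _; rewrite lee_fin.
Qed.

(** The constant curve on the interval [0, 0] has length 0. *)
Lemma geodesic_distance_refl (M : banachManifoldType E) (F : covector_field M) (x : M) :
  (forall u v, 0 <= F u v) -> geodesic_distance F x x = 0%E.
Proof.
move=> F0; apply/eqP; rewrite eq_le geodesic_distance_ge0// andbT.
apply: ereal_inf_lbound; exists 0, 0, (cst x); split => //.
  split; first by apply: continuous_subspaceT; exact: cst_continuous.
  by exists [::].
by rewrite /finsler_length set_itv1 integral_set1.
Qed.

End Nondegeneracy.

Unset Implicit Arguments.

Theorem lemma3p4 (R : realType) (E : completeNormedModType R)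
    (G Ghat : halfLieGroupType E) (p : Ghat -> G)
    (g sigma : bilinear_field G)
    (G_connected : connected [set: G])
    (p_univ : universal_cover p)
    (system : magnetic_system g sigma)
    (sigma_wexact : weakly_exact p sigma)
    (sigma_prim : exists alpha, invariant_primitive (pullback2 p sigma) alpha)
    (kappa : R)
    (kappa_gt : (mane_critical_value p g sigma < kappa%:E)%E)
    (alpha : covector_field Ghat)
    (alpha_prim : invariant_primitive (pullback2 p sigma) alpha)
    (alpha_lt :
      ((2^-1)%:E * sup_norm (pullback2 p g) alpha ^+ 2 < kappa%:E)%E) :
  let d := geodesic_distance (magnetic_finsler (pullback2 p g) alpha kappa) in
  nondegenerate_distance d /\
  [set x : Ghat | d 1%g x = 0%E] = [set 1%g].
Proof.
have [_ _ pdiff _] := p_univ.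
have [grm gst _ _ _] := system.
have [[[alin _] _] _] := alpha_prim.
have [gsm _ _] := grm.
have [gl gr] := pullback2_scalar p gsm.
have [delta d0 Fge] := magnetic_finsler_bound (1%g : Ghat) gl gr alin alpha_lt.
set F := magnetic_finsler (pullback2 p g) alpha kappa in Fge *.
have F0 u v : 0 <= F u v by apply: le_trans (Fge u v); rewrite mulr_ge0 ?sqrtr_ge0 ?ltW.
move=> d.
have nondeg : nondegenerate_distance d.
  move=> x y dxy; apply: contrapT => xy.
  have [r r0 Hr] := finsler_length_lower_bound pdiff grm gst d0 Fge xy.
  have : (r%:E <= d x y)%E.
    by apply: le_ereal_inf_tmp => _ [a [b [c [ab cps ca cb ->]]]]; exact: Hr.
  by rewrite dxy lee_fin leNgt r0.
split => //; apply/seteqP; split => x /= => [/nondeg <- //|->].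
exact: geodesic_distance_refl.
Qed.
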